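(* For $n\geq 5$, let $f_n^2(\sigma)$ be the number of permutations $\pi\in\mathcal{S}_n$ avoiding $\sigma$ with $\theta^2(\pi)=\pi$. Then $f_n^2(213)=4$, $f_n^2(132)=3$, and $f_n^2(123)=0$.
   Context: $\mathcal{S}_n$ is the symmetric group on $[n]$, permutations in one-line notation $\pi_1\cdots\pi_n$. A permutation avoids a pattern $\tau$ if it has no subsequence order-isomorphic to $\tau$. The standard cycle notation of $\pi$ writes each cycle (fixed points included) with its largest element first and orders cycles by increasing largest element. The fundamental bijection $\theta:\mathcal{S}_n\to\mathcal{S}_n$ maps $\pi$ to the permutation whose one-line notation is obtained by erasing the parentheses of the standard cycle notation of $\pi$; $\theta^2=\theta\circ\theta$. *)

(* Defs.v *)
From mathcomp Require Import all_boot all_fingroup.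

Set Implicit Arguments.
Unset Strict Implicit.
Unset Printing Implicit Defensive.

(* Values are shifted by one, so that the word is over [n] = {1, ..., n}. *)
Definition one_line (n : nat) (p : 'S_n) : seq nat :=
  [seq (p i).+1 | i <- enum 'I_n].

Definition order_iso (s t : seq nat) : bool :=
  (size s == size t) &&
  [forall i : 'I_(size s), forall j : 'I_(size s),
     (nth 0 s i < nth 0 s j) == (nth 0 t i < nth 0 t j)].

(* The subsequences of w are the words mask m w, m a bit vector. *)
Definition contains (w tau : seq nat) : bool :=
  [exists m : (size w).-tuple bool, order_iso (mask m w) tau].

Lemma containsP (w tau : seq nat) :
  reflect (exists2 s, subseq s w & order_iso s tau) (contains w tau).
Proof.
apply: (iffP existsP) => [[m Hm]|[s /subseqP[m sz_m ->] Hs]].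
  by exists (mask m w); rewrite // mask_subseq.
by exists (Tuple (introT eqP sz_m)).
Qed.

Definition avoids (n : nat) (p : 'S_n) (tau : seq nat) : bool :=
  ~~ contains (one_line p) tau.

Definition cycle_max (n : nat) (p : 'S_n) (m : 'I_n) : bool :=
  [forall j in porbit p m, j <= m].

(* enum 'I_n is increasing, so the cycles are listed by increasing maximum;
   the cycle with maximum m is written (m, p m, p (p m), ...). *)
Definition std_cycles (n : nat) (p : 'S_n) : seq (seq 'I_n) :=
  [seq traject p m #|porbit p m| | m <- enum 'I_n & cycle_max p m].

Lemma uniq_flatten_map (S T : eqType) (f : S -> seq T) (s : seq S) :
  uniq s -> (forall x, uniq (f x)) ->
  {in s &, forall x y z, z \in f x -> z \in f y -> x = y} ->
  uniq (flatten [seq f x | x <- s]).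
Proof.
move=> + uf; elim: s => //= x s IHs /andP[xs us] dis.
rewrite cat_uniq uf IHs //=; last first.
  by move=> y z ys zs; apply: dis; rewrite inE ?ys ?zs orbT.
rewrite andbT; apply/hasPn => z /flatten_mapP[y ys zy].
apply/negP => zx; move: xs; rewrite (dis x y _ _ z) ?ys //.
  by rewrite mem_head.
by rewrite inE ys orbT.
Qed.

Lemma mem_std_cycles (n : nat) (p : 'S_n) (i : 'I_n) :
  i \in flatten (std_cycles p).
Proof.
have Pi : i \in porbit p i by apply: porbit_id.
case: (arg_maxnP (fun j : 'I_n => j : nat) Pi) => m im max_m.
have em : porbit p i = porbit p m by apply/eqP; rewrite eq_porbit_mem porbit_sym.
apply/flatten_mapP; exists m; last by rewrite -porbit_traject -em.
rewrite mem_filter mem_enum andbT; apply/forall_inP => j.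
by rewrite -em => /max_m.
Qed.

Lemma uniq_std_cycles (n : nat) (p : 'S_n) : uniq (flatten (std_cycles p)).
Proof.
apply: uniq_flatten_map => [|m|m k].
- by rewrite filter_uniq // enum_uniq.
- exact: uniq_traject_porbit.
rewrite !mem_filter => /andP[/forall_inP mm _] /andP[/forall_inP mk _] z.
rewrite -!porbit_traject -!eq_porbit_mem => /eqP em /eqP ek.
apply/val_inj/eqP; rewrite eqn_leq mm ?mk //=.
  by rewrite -ek em porbit_id.
by rewrite -em ek porbit_id.
Qed.

Lemma size_std_cycles (n : nat) (p : 'S_n) : size (flatten (std_cycles p)) = n.
Proof.
rewrite -[RHS]size_enum_ord; apply/perm_size/uniq_perm.
- exact: uniq_std_cycles.
- exact: enum_uniq.
by move=> i; rewrite mem_std_cycles mem_enum.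
Qed.

Definition theta_fun (n : nat) (p : 'S_n) (i : 'I_n) : 'I_n :=
  nth i (flatten (std_cycles p)) i.

Lemma theta_fun_inj (n : nat) (p : 'S_n) : injective (theta_fun p).
Proof.
move=> i j; rewrite /theta_fun (set_nth_default i j) ?size_std_cycles //.
by move/eqP; rewrite nth_uniq ?size_std_cycles ?uniq_std_cycles // => /eqP/val_inj.
Qed.

Definition theta (n : nat) (p : 'S_n) : 'S_n := perm (@theta_fun_inj n p).

Lemma one_line_theta (n : nat) (p : 'S_n) :
  one_line (theta p) = [seq i.+1 | i : 'I_n <- flatten (std_cycles p)].
Proof.
rewrite /one_line (map_comp (fun i : 'I_n => i.+1) (theta p)); congr map.
case: n p => [|n] p.
  by case: (flatten _) => [|[]//]; apply: size0nil; rewrite size_map size_enum_ord.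
apply: (@eq_from_nth _ ord0) => [|k].
  by rewrite size_map size_enum_ord size_std_cycles.
rewrite size_map size_enum_ord => lt_k.
rewrite (nth_map ord0) ?size_enum_ord // permE /theta_fun.
by rewrite nth_enum_ord //; apply: set_nth_default; rewrite size_std_cycles.
Qed.

Definition f2 (n : nat) (sigma : seq nat) : nat :=
  #|[set p : 'S_n | avoids p sigma && (theta (theta p) == p)]|.

(* Main.v *)
Require Import Defs.
From mathcomp Require Import all_boot all_fingroup.
From mathcomp Require Import zify.

(** A pair of words P, W on {0, ..., N} with theta P = W and theta W = P is
  rigid around the top value.  If W a = N and P b = N, the last cycles of P
  and W give P N = a, W N = b and, when a < N (equivalently b < N),
  W (a+1) = a, P (b+1) = b, W (i+1) = P (W i) for a <= i < N and
  P (i+1) = W (P i) for b <= i < N.  Comparing W (a+2) = P a with these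
  recurrences and with the shape of P before its maximum (increasing if P
  avoids 213, decreasing if it avoids 123, above everything that follows if it
  avoids 132), one finds for N >= 4: a 123-avoiding P does not exist, a
  213-avoiding P fixes 0, and a 132-avoiding P fixes N.  Removing that fixed
  point, which theta respects, reduces the last two cases to words of length
  4. *)

Set Implicit Arguments.
Unset Strict Implicit.
Unset Printing Implicit Defensive.

(** * Pairs of words exchanged by theta *)

Definition perm_upto (N : nat) (P : nat -> nat) : Prop :=
  [/\ forall i, i <= N -> P i <= N,
      forall i j, i <= N -> j <= N -> P i = P j -> i = j
    & forall v, v <= N -> exists2 i, i <= N & P i = v].

(* W lists the cycles of P, maxima first: the successor of W i under P is the
   next letter, unless that letter is a left-to-right maximum (or missing), when
   the cycle closes at the largest letter seen so far. *)
Definition cycle_reading (N : nat) (P W : nat -> nat) : Prop :=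
  (forall i j, i < N -> j <= i -> W i.+1 < W j -> P (W i) = W i.+1) /\
  (forall i j, i <= N -> j <= i -> (forall k, k <= i -> W k <= W j) ->
     (i < N -> W j < W i.+1) -> P (W i) = W j).

Definition theta_pair (N : nat) (P W : nat -> nat) : Prop :=
  [/\ perm_upto N P, perm_upto N W, cycle_reading N P W & cycle_reading N W P].

Section TopCycle.

Variables (N : nat) (P W : nat -> nat).
Hypotheses (permW : perm_upto N W) (rPW : cycle_reading N P W).

(** The cycle led by [N] is listed last, so its final letter is the final letter of [W]. *)
Lemma top_cycle_closes : P (W N) = N.
Proof.
have [bW iW sW] := permW; have [a aN Wa] := sW N (leqnn N).
by rewrite -[RHS]Wa; apply: rPW.2 => // [k kN|]; [rewrite Wa bW | lia].
Qed.

(** No letter after [N] is a left-to-right maximum, so all of them belong to the cycle led by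
    [N]. *)
Lemma top_cycle_step a i : W a = N -> a <= i -> i < N -> P (W i) = W i.+1.
Proof.
have [bW iW sW] := permW => Wa ai iN; apply: (rPW.1 i a) => //.
have := bW i.+1 iN; have := iW a i.+1; lia.
Qed.

End TopCycle.

Lemma perm_upto_inv (N : nat) (P : nat -> nat) : perm_upto N P ->
  exists2 Q, forall v, v <= N -> Q v <= N & forall v, v <= N -> P (Q v) = v.
Proof.
case=> _ _ sP; pose s := [seq P i | i <- iota 0 N.+1].
have s_v v : v <= N -> v \in s.
  by move=> /sP[i iN <-]; apply: map_f; rewrite mem_iota.
have lt_idx v : v <= N -> index v s < N.+1.
  by move=> /s_v; rewrite -index_mem size_map size_iota.
exists (index^~ s) => v vN; first exact: lt_idx.
by have := nth_index 0 (s_v v vN); rewrite (nth_map 0) ?nth_iota ?size_iota ?lt_idx.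
Qed.

(** Pigeonhole for intervals. In the 132 case it is applied to the inverse of [P], to turn a
    comparison of letters into numerical bounds. *)
Lemma inj_interval_leq (Q : nat -> nat) (m n c d : nat) :
  (forall v, m <= v < n -> c <= Q v < d) ->
  (forall u v, m <= u < n -> m <= v < n -> Q u = Q v -> u = v) ->
  n - m <= d - c.
Proof.
move=> Qcd iQ; rewrite -(size_iota m (n - m)) -(size_iota c (d - c)).
rewrite -(size_map Q); apply: uniq_leq_size.
  by rewrite map_inj_in_uniq ?iota_uniq // => u v; rewrite !mem_iota => hu hv; apply: iQ; lia.
move=> x /mapP[v]; rewrite !mem_iota => hv ->.
by have := Qcd v; lia.
Qed.

(** * Words whose largest letter is not last *)

Section TopNotFixed.

Variables (N a b : nat) (P W : nat -> nat).
Hypotheses (aN : a < N) (bN : b < N) (Wa : W a = N) (Pb : P b = N).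
Hypothesis pairPW : theta_pair N P W.

Let bP i : i <= N -> P i <= N. Proof. by case: pairPW => -[+ _ _] _ _ _; apply. Qed.
Let iP i j : i <= N -> j <= N -> P i = P j -> i = j.
Proof. by case: pairPW => -[_ + _] _ _ _; apply. Qed.
Let sP v : v <= N -> exists2 i, i <= N & P i = v.
Proof. by case: pairPW => -[_ _ +] _ _ _; apply. Qed.
Let bW i : i <= N -> W i <= N. Proof. by case: pairPW => _ [+ _ _] _ _; apply. Qed.
Let iW i j : i <= N -> j <= N -> W i = W j -> i = j.
Proof. by case: pairPW => _ [_ + _] _ _; apply. Qed.

(** [W] sends both sides to [N]: the last cycle of [W], listed by [P], closes at [N]. *)
Let PN : P N = a.
Proof.
case: pairPW => pP pW rPW rWP.
by apply: iW; [exact: bP | lia | rewrite Wa (top_cycle_closes pP rWP)].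
Qed.
Let WN : W N = b.
Proof.
case: pairPW => pP pW rPW rWP.
by apply: iP; [exact: bW | lia | rewrite Pb (top_cycle_closes pW rPW)].
Qed.
Let stepW i : a <= i -> i < N -> W i.+1 = P (W i).
Proof. by case: pairPW => pP pW rPW rWP ai iN; rewrite (top_cycle_step pW rPW Wa). Qed.
Let stepP i : b <= i -> i < N -> P i.+1 = W (P i).
Proof. by case: pairPW => pP pW rPW rWP ai iN; rewrite (top_cycle_step pP rWP Pb). Qed.
Let Wa1 : W a.+1 = a. Proof. by rewrite stepW // Wa. Qed.
Let Pb1 : P b.+1 = b. Proof. by rewrite stepP // Pb. Qed.
Let Wa2 : a.+2 <= N -> W a.+2 = P a. Proof. by move=> h; rewrite stepW ?Wa1. Qed.
Let Wa3 : a.+3 <= N -> W a.+3 = P (P a).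
Proof. by move=> h; rewrite stepW ?Wa2 //; lia. Qed.

(** The letters of [P] before its maximum decrease, hence form one cycle of [W], while the letters
    of [W] after its maximum are iterates of [P]. Whenever both descriptions yield the same letter
    of [W], injectivity gives a value of [P]; these values accumulate until two collide or a 123
    appears. *)
Lemma avoid123_top : 4 <= N ->
  (forall i j k, i < j -> j < k -> k <= N -> P i < P j -> P j < P k -> False) ->
  False.
Proof.
move=> N4 av.
(* An ascent before position [b] would be completed to a 123 by [N]. *)
have Ldec i j : i < j -> j < b -> P j < P i.
  move=> ij jb; have := av i j b ij jb; have := @bP i; have := @bP j.
  have := @iP i j; have := @iP j b; lia.
have [nonrec_P rec_max] : cycle_reading N W P by case: pairPW.
have [nonrec_W _] : cycle_reading N P W by case: pairPW.
(* After its first letter a decreasing prefix has no left-to-right maximum, so its cycle closes only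
   when [N] arrives at [b]. *)
have Lcyc i : i.+1 < b -> W (P i) = P i.+1.
  by move=> ib; apply: (nonrec_P i i); rewrite ?Ldec //; lia.
have Lclose : 0 < b -> W (P b.-1) = P 0.
  move=> b0; apply: rec_max; try lia.
    move=> [|k] kb //; apply/ltnW/Ldec; lia.
  rewrite prednK // Pb => _; have := @bP 0; have := @iP 0 b; lia.
case: (ltngtP a b) => [ab|ba|ab].
- case: (posnP a) => [a0|a1].
    have W0 : W 0 = N by rewrite -a0.
    have W1 : W 1 = 0 by have := Wa1; rewrite a0.
    have W2 : W 2 = P 0 by have := Wa2; rewrite a0; apply; lia.
    (* The prefix cycle closes at [P 0], which is also the letter [W 2]. *)
    have Pb' : P b.-1 = 2.
      by apply: iW; [apply: bP; lia | lia | rewrite Lclose ?W2 //; lia].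
    have W3 : W 3 = P (P 0) by have := Wa3; rewrite a0; apply; lia.
    have [b1|[b2|b3]] : b = 1 \/ b = 2 \/ 3 <= b by lia.
    + have P2 : P 2 = 1 by rewrite -{2}b1 -Pb1 b1.
      move: Pb'; rewrite b1 /= => P0.
      have := @iW 3 N; rewrite W3 P0 P2 WN; lia.
    + have := @iP b.-1 b.+1; lia.
    (* The ascent from [P b.-1 = 2] to [P b.+1 = b] must not be extended. *)
    have later k : b.+1 < k -> k <= N -> P k < b.
      move=> bk kN; have := av b.-1 b.+1 k; have := @iP b.+1 k; lia.
    have bN2 : b <= N - 2.
      have : b.+1 <> N by move=> e; have := Pb1; rewrite e PN; lia.
      lia.
    have P0 : P 0 = N.-1.
      have [j jN Pj] := @sP N.-1 (leq_pred N).
      have jb1 : j <> b.+1 by move=> e; move: Pj; rewrite e Pb1; lia.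
      have jb : j < b.
        have := later j; have : j <> b by move=> e; move: Pj; rewrite e Pb; lia.
        lia.
      case: j jN Pj jb1 jb => // j jN Pj jb1 jb.
      have := Ldec 0 j.+1; have := @bP 0; have := @iP 0 b; lia.
    have [b2|b2] : b.+1 = N.-1 \/ b.+1 < N.-1 by lia.
      have := @iW 3 N; rewrite W3 P0 -b2 Pb1 WN; lia.
    have PN1 : P N.-1 = 1.
      apply: iW; [apply: bP; lia | lia | ].
      rewrite W1 -stepP; try lia.
      by rewrite prednK ?PN ?a0 //; lia.
    have W4 : W 4 = P 1 by rewrite stepW ?W3 ?P0 ?PN1 //; lia.
    (* [W] would carry the letter [P 1] at both positions 4 and [N.-1], the latter being [P 0]. *)
    have := @iW 4 N.-1; rewrite W4 -P0 Lcyc; lia.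
  (* [W] takes the value [P a] at [P a.-1], by the prefix cycle, and at [a.+2], by the top cycle. *)
  have Pa1 : P a.-1 = a.+2.
    apply: iW; [apply: bP; lia | lia | ].
    rewrite Lcyc ?prednK // Wa2 //; lia.
  have Pab : P a <> b by have := @iP a b.+1; lia.
  have a3 : a.+3 <= N.
    have : a.+2 <> N by move=> e; have := Wa2; rewrite e WN; lia.
    lia.
  have Pa_lt : P a < a.
    have Pa_le : P a <= a.+1 by have := Ldec a.-1 a; lia.
    have : P a <> a by have := @iP a N; lia.
    have : P a <> a.+1.
      move=> e; have [ab1|ab1] : a.+1 < b \/ a.+1 = b by lia.
        have := @iW a.+3 a.+1; rewrite Wa3 // e Wa1 -(Lcyc a) // e Wa1; lia.
      lia.
    lia.
  (* The comparison is repeated with [P a] in place of [a]. If [P a = 0] it has no predecessor, and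
     the closing of the prefix cycle is used instead. *)
  have [c0|c1] := posnP (P a).
    have Pb' : P b.-1 = a.+3.
      apply: iW; [apply: bP; lia | lia | ].
      rewrite Lclose ?Wa3 ?c0 //; lia.
    have [|] : a < b.-1 \/ a = b.-1 by lia.
      move/Ldec; lia.
    by move=> e; move: c0; rewrite e Pb'; lia.
  have Pc1 : P (P a).-1 = a.+3.
    apply: iW; [apply: bP; lia | lia | ].
    rewrite Lcyc ?prednK ?Wa3 //; lia.
  (* The decreasing prefix has the consecutive values [a.+3] at [(P a).-1] and [a.+2] at [a.-1], so
     no position lies between these two. *)
  have Pa_eq : P a = a.-1.
    have [|//] : P a < a.-1 \/ P a = a.-1 by lia.
    move=> lt; have := Ldec (P a) a.-1; have := Ldec (P a).-1 (P a); lia.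
  have a4 : a.+4 <= N.
    have : a.+3 <> N by move=> e; have := @iP (P a).-1 b; lia.
    lia.
  have Wa4 : W a.+4 = P a.+2.
    rewrite stepW; try lia.
    by rewrite Wa3 // Pa_eq Pa1.
  have [b2|[b2|b2]] : a.+2 < b \/ b = a.+2 \/ b = a.+1 by lia.
  + have : P a.+1 = a.+4.
      apply: iW; [apply: bP; lia | lia | ].
      by rewrite Lcyc // Wa4.
    have := Ldec a a.+1; lia.
  + have := @iW a.+4 a; rewrite Wa4 Wa -b2 Pb; lia.
  have Pa3 : P a.+3 = a.
    rewrite stepP; try lia.
    by rewrite -{1}b2 Pb1 b2 Wa1.
  have := @iP a.+3 N; lia.
- have aN2 : a <= N - 2.
    have : a.+1 <> N by move=> e; have := Wa1; rewrite e WN; lia.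
    lia.
  have [b0|b1] := posnP b.
    have P0 : P 0 = N by rewrite -b0.
    have P1 : P 1 = 0 by have := Pb1; rewrite b0.
    have a_1 : a = 1.
      have [j jN Pj] := @sP 1 ltac:(lia).
      have jN' : j = N.
        have j0 : j <> 0 by move=> e; move: Pj; rewrite e P0; lia.
        have j1 : j <> 1 by move=> e; move: Pj; rewrite e P1; lia.
        have := av 1 j N; have := @iP j N; lia.
      by rewrite -PN -jN'.
    have := @iW 3 N; rewrite WN b0; have := Wa2; rewrite a_1 P1; lia.
  (* The letters [b] at [b.+1] and [a] at [N] form an ascent, which no smaller letter may
     precede. *)
  have small v k : v < b -> k <= N -> P k = v -> b.+1 < k.
    move=> vb kN Pk.
    have kb : k <> b by move=> e; move: Pk; rewrite e Pb; lia.
    have kb1 : k <> b.+1 by move=> e; move: Pk; rewrite e Pb1; lia.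
    have := av k b.+1 N; lia.
  (* If [a = b.+1], then [a.+2 = N] and [N.-1] is the only position for letters below [b]; hence
     [b = 1] and [N = 4]. *)
  have [ab|ab] : a = b.+1 \/ b.+2 <= a by lia.
    have aN' : a.+2 = N.
      apply: iW; try lia.
      by rewrite Wa2 ?WN ?ab ?Pb1 //; lia.
    have small' v : v < b -> P N.-1 = v.
      move=> vb; have [k kN Pk] := @sP v ltac:(lia).
      have := small v k vb kN Pk.
      have : k <> N by move=> e; move: Pk; rewrite e PN; lia.
      by move=> ? ?; rewrite (_ : N.-1 = k) //; lia.
    have b_1 : b = 1.
      have [|//] : 1 < b \/ b = 1 by lia.
      by move=> b2; have := small' 0; have := small' 1; lia.
    have PN1 := small' 0 b1.
    have P0 : P 0 = 3.
      have N4' : N = 4 by lia.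
      have [k kN Pk] := @sP 3 ltac:(lia).
      have k1 : k <> b by move=> e; move: Pk; rewrite e Pb; lia.
      have k2 : k <> b.+1 by move=> e; move: Pk; rewrite e Pb1; lia.
      have k3 : k <> N.-1 by move=> e; move: Pk; rewrite e PN1; lia.
      have k4 : k <> N by move=> e; move: Pk; rewrite e PN; lia.
      by rewrite -Pk; congr P; lia.
    by have := Lclose b1; have := Wa1; rewrite ab b_1 /= P0; lia.
  have Pa1 : P a.-1 = a.+2.
    apply: iW; [apply: bP; lia | lia | ].
    rewrite -stepP ?prednK ?Wa2 //; lia.
  have a3 : a.+3 <= N.
    have := @iP a.-1 b; lia.
  have ab2 : b.+2 < a.
    have : a.-1 <> b.+1 by move=> e; move: Pa1; rewrite e Pb1; lia.
    lia.
  have Rdec j k : b.+1 < j -> j < k -> k <= N -> b < P j -> P k < P j.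
    move=> bj jk kN bPj; have := av b.+1 j k; have := @iP j k; lia.
  (* A letter between the two ends of the ascent from [b] at [b.+1] to [a] at [N] would complete a
     123 if it stood after the maximum. *)
  have mid v : b < v -> v < a -> exists2 j, j < b & P j = v.
    move=> bv va; have [j jN Pj] := @sP v ltac:(lia); exists j => //.
    have jb : j <> b by move=> e; move: Pj; rewrite e Pb; lia.
    have jb1 : j <> b.+1 by move=> e; move: Pj; rewrite e Pb1; lia.
    have jN' : j <> N by move=> e; move: Pj; rewrite e PN; lia.
    have := av b.+1 j N; lia.
  (* Otherwise [P a] is below [a.+2] by [Rdec], and the letters from [b] to [a] have their places
     elsewhere. This leaves [a.+1], after which [stepP] would produce a second [a]. *)
  have Pa_small : P a < b.
    have [//|big] : P a < b \/ b <= P a by lia.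
    have PabNe : P a <> b by have := @iP a b.+1; lia.
    have PaaNe : P a <> a by have := @iP a N; lia.
    have Pa_ub : P a < a.+2 by rewrite -Pa1; apply: Rdec; lia.
    have Pa_lb : a < P a.
      have [//|lt] : a < P a \/ P a < a by lia.
      have [j jb Pj] := mid (P a) ltac:(lia) lt.
      have := @iP j a; lia.
    have e : P a = a.+1 by lia.
    have Pa2 : P a.+1 = a by rewrite stepP ?e ?Wa1 //; lia.
    have := @iP a.+1 N; lia.
  have [c0|c1] := posnP (P a).
    have Pb' : P b.-1 = a.+3.
      apply: iW; [apply: bP; lia | lia | ].
      rewrite Lclose ?Wa3 ?c0 //; lia.
    have [j jb Pj] := mid b.+1 ltac:(lia) ltac:(lia).
    have [e|/Ldec] : j = b.-1 \/ j < b.-1 by lia.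
      by move: Pj; rewrite e Pb'; lia.
    lia.
  have Pc1 : P (P a).-1 = a.+3.
    apply: iW; [apply: bP; lia | lia | ].
    rewrite Lcyc ?prednK ?Wa3 //; lia.
  have a4 : a.+4 <= N.
    have := @iP (P a).-1 b; lia.
  have Wa4 : W a.+4 = P (P (P a)) by rewrite stepW ?Wa3 //; lia.
  (* The letter [a.-1] lies in the decreasing prefix, not before [P a]. Once [a], [a.+1] and [a.+2]
     are excluded as values of [P (P a)], it must stand at [P a] itself. *)
  have Pc : P (P a) = a.-1.
    have ub : P (P a) < a.+3 by rewrite -Pc1; apply: Ldec; lia.
    have ne2 : P (P a) <> a.+2 by have := @iP (P a) a.-1; lia.
    have ne0 : P (P a) <> a by have := @iP (P a) N; lia.
    have ne1 : P (P a) <> a.+1.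
      move=> e; have := @iW a.+4 (P a); rewrite Wa4 e stepP; lia.
    have [j jb Pj] := mid a.-1 ltac:(lia) ltac:(lia).
    have jge : P a <= j.
      have [//|jlt] : P a <= j \/ j < P a by lia.
      have [e|/Ldec] : j = (P a).-1 \/ j < (P a).-1 by lia.
        by move: Pj; rewrite e Pc1; lia.
      lia.
    have [e|/Ldec] : j = P a \/ P a < j by lia.
      by rewrite -e.
    lia.
  have Wa4' : W a.+4 = a.+2 by rewrite Wa4 Pc Pa1.
  have a5 : a.+4 < N.
    have : a.+4 <> N by move=> e; move: Wa4'; rewrite e WN; lia.
    lia.
  (* This exceeds [P a.-1 = a.+2], against the decrease [Rdec] of the large letters after [b.+1]. *)
  have Pa2 : P a.+1 = a.+4.+1.
    apply: iW; [apply: bP; lia | lia | ].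
    rewrite -stepP; try lia.
    by rewrite stepW ?Wa4' //; lia.
  have := Rdec a.-1 a.+1; lia.
(* Here [P] must be N-2, ..., 0, N, N-1, and [W] would begin with N-2, 0, N-2. *)
- have aN1 : a = N.-1.
    have [|//] : a.+2 <= N \/ a = N.-1 by lia.
    by move=> h; have := @iW a.+2 a; rewrite Wa2 // Wa ab Pb; lia.
  have P0 : P 0 = N.-2.
    have [[|j] jN Pj] := @sP N.-2 ltac:(lia); first by [].
    have jb : j.+1 <> b by move=> e; move: Pj; rewrite e Pb; lia.
    have jN' : j.+1 <> N by move=> e; move: Pj; rewrite e PN; lia.
    have := Ldec 0 j.+1; have := @iP 0 b; have := @iP 0 N; have := @bP 0; lia.
  have PN2 : P N.-2 = 0.
    have [k kN Pk] := @sP 0 ltac:(lia).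
    have kb : k <> b by move=> e; move: Pk; rewrite e Pb; lia.
    have kN' : k <> N by move=> e; move: Pk; rewrite e PN; lia.
    have [k2|k2] : k = N.-2 \/ k < N.-2 by lia.
      by rewrite -k2.
    have := Ldec k N.-2; lia.
  have W0 : W 0 = N.-2.
    by rewrite -P0 -Lclose; [congr W; rewrite -PN2; congr P; lia | lia].
  have Wsmall i : 0 < i -> i < N.-1 -> W i < N.-2.
    move=> i0 iN; have := @bW i; have := @iW i 0; have := @iW i a; have := @iW i N; lia.
  have W1 : W 1 = 0.
    by rewrite -(nonrec_W 0 0) ?W0 ?PN2 ?Wsmall //; lia.
  have : W 2 = P 0 by rewrite -(nonrec_W 1 0) ?W1 ?W0 ?Wsmall //; lia.
  have := Wsmall 2; lia.
Qed.

(** The letters up to the maximum increase, so each one before it is a one-letter cycle of [W]. If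
    [P 0] is nonzero and [0 < b], these fixed points clash with the letters of [W] after [N]. If
    [b = 0], the letters 1, 2, N-1 and N-2 are located in [P] until a 213 appears. *)
Lemma avoid213_top : 4 <= N ->
  (forall i j k, i < j -> j < k -> k <= N -> P j < P i -> P i < P k -> False) ->
  P 0 = 0.
Proof.
move=> N4 av; have [//|/eqP P0ne] := eqVneq (P 0) 0; exfalso.
have [_ rec_max] : cycle_reading N W P by case: pairPW.
have [nonrec_W _] : cycle_reading N P W by case: pairPW.
have Linc i j : i < j -> j <= b -> P i < P j.
  move=> ij jb; have [e|lt] : j = b \/ j < b by lia.
    by rewrite e Pb; have := @bP i; have := @iP i b; lia.
  have := av i j b ij lt; have := @bP i; have := @bP j.
  have := @iP i j; have := @iP i b; have := @iP j b; lia.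
have Lfix i : i < b -> W (P i) = P i.
  move=> ib; apply: rec_max => //; first lia.
    move=> k; rewrite leq_eqVlt => /predU1P[->//|ki].
    by apply/ltnW/Linc; lia.
  by move=> _; apply: Linc.
(* Each letter before this position of 0 exceeds the final letter [a]: otherwise it forms a 213 with
   0 and [a]. *)
have [k kN Pk] := @sP 0 ltac:(lia).
have k0 : 0 < k by case: k Pk kN => // Pk; lia.
have [b0|b1] := posnP b; last first.
  have kb1 : k <> b.+1 by move=> e; move: Pk; rewrite e Pb1; lia.
  have kb : b.+1 < k by have := Linc 0 k; have := @iP 0 k; lia.
  have P0a : a < P 0.
    have [e|lt] : k = N \/ k < N by lia.
      have := PN; rewrite -e Pk; lia.
    have := av 0 k N; have := @iP 0 N; lia.
  have ab : a < b.
    have [e|lt] : k = N \/ k < N by lia.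
      have := PN; rewrite -e Pk; lia.
    have := av b.+1 k N; have := @iP b.+1 N; lia.
  have Pa : P a = a.+2.
    by apply: iW; [apply: bP; lia | lia | rewrite Lfix // Wa2 //; lia].
  (* The increasing letters from [P 0 > a] to [P a = a.+2] have too little room when [2 <= a]. *)
  have [a2|[a1|a0]] : 2 <= a \/ a = 1 \/ a = 0 by lia.
  - have := Linc 0 1; have := Linc 1 a; lia.
  - have P0 : P 0 = 2 by have := Linc 0 1; rewrite a1 in P0a Pa; lia.
    have := Lfix 0 b1; have := Wa1; rewrite P0 a1; lia.
  have P0 : P 0 = 2 by rewrite -a0 Pa a0.
  have W0 : W 0 = N by rewrite -a0.
  have W3 : W 3 = P 2.
    by have := Wa3; rewrite a0 P0; apply; lia.
  have [b3|[b2|b_1]] : 3 <= b \/ b = 2 \/ b = 1 by lia.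
  - have P2 : P 2 = 3.
      by apply: iW; [apply: bP; lia | lia | rewrite Lfix // W3].
    have := Linc 0 1; have := Linc 1 2; lia.
  - have := @iW 3 0; rewrite W3 W0 -b2 Pb; lia.
  have := @iW 3 N; rewrite W3 WN; have := Pb1; rewrite b_1; lia.
(* From here [b = 0], so [P] begins with N, 0 and [stepP] applies at every position. *)
have P0 : P 0 = N by rewrite -b0.
have P1 : P 1 = 0 by have := Pb1; rewrite b0.
have W0 : W 0 = P 2 by rewrite stepP ?P1 ?b0 //; lia.
have aN2 : a <= N - 2.
  have : a.+1 <> N by move=> e; have := Wa1; rewrite e WN; lia.
  lia.
have a3 : 3 <= a.
  have : a <> 0 by have := @iP 1 N; lia.
  have : a <> 1.
    move=> e; have := @iW 3 N; rewrite WN b0; have := Wa2; rewrite e P1; lia.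
  have : a <> 2.
    move=> e; have := @iW 4 0; rewrite W0; have := Wa2; rewrite e; lia.
  lia.
have WN1 : W N.-1 = 1.
  apply: iP; [apply: bW; lia | lia | ].
  by rewrite -stepW ?prednK ?WN ?P1 //; lia.
have aN3 : a.+3 <= N.
  have : a.+2 <> N by move=> e; move: WN1; rewrite -e /= Wa1; lia.
  lia.
(* The position of the letter 1 in [P], later called [q.+1]. Stepping back from the end shows that
   [W] ends in [q.+1], 1, 0. *)
have [q' q'N Pq'] := @sP 1 ltac:(lia).
have q'0 : q' <> 0 by move=> e; move: Pq'; rewrite e; lia.
have [q q'E] : exists q, q' = q.+1 by exists q'.-1; lia.
rewrite {q' q'0}q'E in q'N Pq'.
have qN : q.+1 < N.
  have : q.+1 <> N by move=> e; move: Pq'; rewrite e PN; lia.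
  lia.
have Pq : P q = N.-1.
  by apply: iW; [apply: bP; lia | lia | rewrite -stepP ?b0 // Pq' WN1].
have q2 : 2 <= q.
  have : q <> 0 by move=> e; move: Pq; rewrite e P0; lia.
  have : q <> 1 by move=> e; move: Pq; rewrite e P1; lia.
  lia.
have WN2 : W N.-2 = q.+1.
  apply: iP; [apply: bW; lia | lia | ].
  rewrite -stepW; try lia.
  by rewrite Pq' -WN1; congr W; lia.
have [r rN Pr] := @sP N.-2 ltac:(lia).
have rN1 : r < N.
  have : r <> N by move=> e; move: Pr; rewrite e PN; lia.
  lia.
have Pr1 : P r.+1 = q.+1 by rewrite stepP ?b0 // Pr.
have ge2 j : 2 <= j -> j <= N -> j <> q.+1 -> 2 <= P j.
  have := @iP j 1; have := @iP j q.+1; lia.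
(* Otherwise [P j], the letter 1 at [q.+1] and the final [a] form a 213. *)
have bef j : 2 <= j -> j <= q -> a < P j.
  move=> j2 jq; have := av j q.+1 N; have := ge2 j; have := @iP j N; lia.
have r2 : 2 <= r.
  have : r <> 0 by move=> e; move: Pr; rewrite e P0; lia.
  have : r <> 1 by move=> e; move: Pr; rewrite e P1; lia.
  lia.
have rq : r <> q by move=> e; move: Pr; rewrite e Pq; lia.
have rq1 : r <> q.+1 by move=> e; move: Pr; rewrite e Pq'; lia.
have [s sN Ps] := @sP 2 ltac:(lia).
have s0 : s <> 0 by move=> e; move: Ps; rewrite e P0; lia.
have s1 : s <> 1 by move=> e; move: Ps; rewrite e P1; lia.
have sq1 : s <> q.+1 by move=> e; move: Ps; rewrite e Pq'; lia.
have sN' : s <> N by move=> e; move: Ps; rewrite e PN; lia.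
have sq : q < s by have := bef s; lia.
(* If N-2 precedes N-1, avoidance makes them adjacent; then [q = N - 2], and no position is left for
   the letter 2. *)
have [ltrq|ltqr] : r < q \/ q.+1 < r by lia.
  have rq' : r.+1 = q.
    have := av r r.+1 q; have := @iP r.+1 q; have := @iP r r.+1; lia.
  by move: Pr1; rewrite rq' Pq; lia.
(* If [2 < q], then [P 2], the letter 1 and the letter N-2 form a 213. *)
have q_2 : q = 2.
  have [//|lt] : q = 2 \/ 2 < q by lia.
  have ne0 : P 2 <> N by rewrite -P0; have := @iP 2 0; lia.
  have ne1 : P 2 <> N.-1 by rewrite -Pq; have := @iP 2 q; lia.
  have ne2 : P 2 <> N.-2 by rewrite -Pr; have := @iP 2 r; lia.
  have lb : 1 < P 2 by apply: ge2; lia.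
  have ub : P 2 <= N by apply: bP; lia.
  by case: (av 2 q.+1 r); lia.
rewrite q_2 in Pq Pq' Pr1 ltqr sq sq1.
(* The letter 2 is at [s] and N-2 at [r]. If 2 comes first, it must stand at 4 and also at [N.-1],
   leaving no place for N-2. If it comes later, [P r.+1 = 3], 2 and the final [a] form a 213. *)
have [ltsr|[e|ltrs]] : s < r \/ s = r \/ r < s by lia.
- have s4 : s = 4.
    have [//|lt] : s = 4 \/ 4 < s by lia.
    have ne0 : P 4 <> N by rewrite -P0; have := @iP 4 0; lia.
    have ne1 : P 4 <> N.-1 by rewrite -Pq; have := @iP 4 2; lia.
    have ne2 : P 4 <> N.-2 by rewrite -Pr; have := @iP 4 r; lia.
    have ne3 : P 4 <> 2 by have := @iP 4 s; lia.
    have lb : 1 < P 4 by apply: ge2; lia.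
    have ub : P 4 <= N by apply: bP; lia.
    by case: (av 4 s r); lia.
  have W1 : W 1 = 2 by rewrite -Pq' -stepP ?b0 -?s4 //; lia.
  have PN1 : P N.-1 = 2.
    by rewrite -[RHS]W1 -(nonrec_W 0 0) ?W0 ?W1 ?Pq //; lia.
  have e : N.-1 = s by apply: iP; lia.
  have N5 : N = 5 by lia.
  by have := @iP r r.+1; lia.
- by move: Pr; rewrite -e Ps; lia.
have sr1 : s <> r.+1 by move=> e; move: Ps; rewrite e Pr1.
have := av r.+1 s N; have := @iP r.+1 N; lia.
Qed.

(** Letters before the maximum exceed those after it, so the former are at least [N - b] and the
    latter are below [N - b]. It follows that [W] keeps positions from [N - b] to [N - 1] at values
    at least [N - b], whereas the top-cycle recurrence eventually makes such a value a letter of [P]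
    after [b]. *)
Lemma avoid132_top : 4 <= N ->
  (forall i j k, i < j -> j < k -> k <= N -> P i < P k -> P k < P j -> False) ->
  False.
Proof.
move=> N4 av.
have LR i j : i < b -> b < j -> j <= N -> P j < P i.
  move=> ib bj jN; have := av i b j ib bj jN; have := @bP j.
  have := @iP i j; have := @iP j b; lia.
have [Q QN PQ] := perm_upto_inv (let: And4 pP _ _ _ := pairPW in pP).
have iQ u v : u <= N -> v <= N -> Q u = Q v -> u = v.
  by move=> uN vN e; rewrite -(PQ u) // e PQ.
have Rle j : b < j -> j <= N -> P j < N - b.
  move=> bj jN; have PjN := @bP j jN.
  (* All values up to [P j] sit after position [b], where there are [N - b] positions. *)
  suff : (P j).+1 - 0 <= N.+1 - b.+1 by lia.
  apply: (@inj_interval_leq Q) => [v vj|u v uj vj]; last by apply: iQ; lia.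
  have vN : v <= N by lia.
  have := QN v vN; have := PQ v vN; have := @LR (Q v) j; have := @iP j b.
  have [e|] : Q v = b \/ Q v <> b by lia.
    by rewrite e; lia.
  lia.
have Lge i : i < b -> N - b <= P i.
  move=> ib; have PiN := @bP i ltac:(lia).
  suff : N.+1 - P i <= b.+1 - 0 by lia.
  apply: (@inj_interval_leq Q) => [v vi|u v ui vi]; last by apply: iQ; lia.
  have vN : v <= N by lia.
  have := QN v vN; have := PQ v vN; have := @LR i (Q v); lia.
have b2 : b.+1 + b <= N by have := Rle b.+1; lia.
have aR : a < N - b by rewrite -PN; apply: Rle; lia.
(* Writing [W v = P i], the case [b < i] would give [v = P i.-1] by [stepP], which is either [N] or
   below [N - b]. *)
have Wbig v : N - b <= v -> v < N -> N - b <= W v.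
  move=> vb vN; have [i iN Pi] := @sP (W v) (@bW v (ltnW vN)).
  have [ib|[ib|ib]] : i < b \/ i = b \/ b < i by lia.
  - by rewrite -Pi Lge.
  - have : v = a by apply: iW; try lia; rewrite -Pi ib Pb Wa.
    lia.
  have e : v = P i.-1.
    by apply: iW; [lia | apply: bP; lia | rewrite -stepP ?prednK ?Pi //; lia].
  have [e'|lt] : i.-1 = b \/ b < i.-1 by lia.
    by move: e; rewrite e' Pb; lia.
  have := Rle i.-1; lia.
have [b0|[b1|b_2]] : b = 0 \/ b = 1 \/ 2 <= b by lia.
- have P1 : P 1 = 0 by have := Pb1; rewrite b0.
  have P0 : P 0 = N by rewrite -b0.
  have [j jN Pj] := @sP N.-1 ltac:(lia).
  have j0 : j <> 0 by move=> e; move: Pj; rewrite e P0; lia.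
  have j1 : j <> 1 by move=> e; move: Pj; rewrite e P1; lia.
  have jN' : j = N.
    have := av 1 j N; have := @iP j N; have := @iP 1 N; have := @iP 0 N.
    have := @bP N; lia.
  have aN1 : a = N.-1 by rewrite -PN -Pj jN'.
  by have := Wa1; rewrite aN1 prednK ?WN; lia.
- have WN1 : W N.-1 = N.-1.
    have := Wbig N.-1; have := @bW N.-1; have := @iW N.-1 a; lia.
  have := @stepW N.-1; rewrite prednK ?WN ?WN1; try lia.
  have := @iP N.-1 b.+1; lia.
(* The position [W N.-2] is at least [N - b], hence after [b]; so the letter of [P] there is below
   [N - b], against [Wbig] at [N.-1]. *)
have e : W N.-1 = P (W N.-2).
  by rewrite -stepW ?[in RHS](_ : N.-2.+1 = N.-1) //; lia.
have := Wbig N.-1; have := Wbig N.-2; have := Rle (W N.-2); have := @bW N.-2.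
lia.
Qed.

End TopNotFixed.

(** Here [P] must be N-1, ..., 0, N, and [W] would begin with N-1, 0, N-1. *)
Lemma avoid123_fixed_top (N : nat) (P W : nat -> nat) :
  4 <= N -> theta_pair N P W -> P N = N ->
  (forall i j k, i < j -> j < k -> k <= N -> P i < P j -> P j < P k -> False) ->
  False.
Proof.
move=> N4 [pP pW rPW rWP] PN av.
have [bP iP sP] := pP; have [bW iW sW] := pW.
have WN : W N = N by rewrite -{1}PN (top_cycle_closes pP rWP).
have dec i j : i < j -> j < N -> P j < P i.
  move=> ij jN; have := av i j N ij jN; have := bP i; have := bP j.
  have := iP i j; have := iP j N; lia.
have P0 : P 0 = N.-1.
  have [[|j] jN Pj] := sP N.-1 ltac:(lia); first by [].
  have jN' : j.+1 <> N by move=> e; move: Pj; rewrite e PN; lia.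
  have := dec 0 j.+1; have := iP 0 N; have := bP 0; lia.
have PN1 : P N.-1 = 0.
  have [k kN Pk] := sP 0 ltac:(lia).
  have kN' : k <> N by move=> e; move: Pk; rewrite e PN; lia.
  have [e|lt] : k = N.-1 \/ k < N.-1 by lia.
    by rewrite -e.
  have := dec k N.-1; lia.
have W0 : W 0 = N.-1.
  rewrite -[RHS]P0 -{1}PN1; apply: rWP.2; try lia.
    by move=> [|k] kN //; apply/ltnW/dec; lia.
  by rewrite prednK ?PN ?P0; lia.
have Wlt i : 0 < i -> i < N -> W i < N.-1.
  move=> i0 iN; have := bW i; have := iW i 0; have := iW i N; lia.
have W1 : W 1 = 0 by rewrite -(rPW.1 0 0) ?W0 ?PN1 ?Wlt //; lia.
have : W 2 = P 0 by rewrite -(rPW.1 1 0) ?W1 ?W0 ?Wlt //; lia.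
have := Wlt 2; lia.
Qed.

(** * Cycle readings of finite words *)

Local Notation max_seq := (foldr maxn 0).

(** Computable form of the two clauses of [cycle_reading]. The [has] test says that the next letter
    is not a left-to-right maximum; failing that, the running maximum, which leads the current
    cycle, is returned. *)
Definition next_in_cycle (w : seq nat) (i : nat) : nat :=
  if (i.+1 < size w) && has (ltn (nth 0 w i.+1)) (take i.+1 w)
  then nth 0 w i.+1 else max_seq (take i.+1 w).

Definition reads_as (s w : seq nat) : bool :=
  all (fun i => nth 0 s (nth 0 w i) == next_in_cycle w i) (iota 0 (size w)).

Lemma reads_asP (s w : seq nat) :
  reflect (forall i, i < size w -> nth 0 s (nth 0 w i) = next_in_cycle w i)
          (reads_as s w).
Proof.
apply: (iffP allP) => h i.
  by move=> iw; apply/eqP/h; rewrite mem_iota.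
by rewrite mem_iota => iw; apply/eqP/h.
Qed.

Lemma leq_max_seq (t : seq nat) (x : nat) : x \in t -> x <= max_seq t.
Proof. elim: t => //= y t IH; rewrite inE => /predU1P[->|/IH]; lia. Qed.

Lemma max_seq_leq (t : seq nat) (m : nat) :
  {in t, forall x, x <= m} -> max_seq t <= m.
Proof.
elim: t => //= y t IH h; rewrite geq_max h ?mem_head //=.
by apply: IH => x xt; apply: h; rewrite inE xt orbT.
Qed.

Lemma max_seqE (t : seq nat) (m : nat) :
  m \in t -> {in t, forall x, x <= m} -> max_seq t = m.
Proof.
by move=> mt h; apply/eqP; rewrite eqn_leq max_seq_leq // leq_max_seq.
Qed.

Lemma mem_takeP (w : seq nat) (m x : nat) : m <= size w ->
  reflect (exists2 k, k < m & nth 0 w k = x) (x \in take m w).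
Proof.
move=> mw; apply: (iffP (nthP 0)); rewrite size_takel // => -[k km <-].
  by exists k; rewrite // nth_take.
by exists k; rewrite // nth_take.
Qed.

Lemma reads_as_cycle_reading (N : nat) (s w : seq nat) :
  size w = N.+1 -> reads_as s w -> cycle_reading N (nth 0 s) (nth 0 w).
Proof.
move=> szw /reads_asP r; split=> i j iN ji.
  move=> lt; rewrite r ?szw; last lia.
  rewrite /next_in_cycle szw ltnS iN /=; case: hasP => // -[]; exists (nth 0 w j) => //.
  by apply/mem_takeP; [lia | exists j].
move=> jmax rec; rewrite r ?szw ?ltnS // /next_in_cycle szw.
have mE : max_seq (take i.+1 w) = nth 0 w j.
  apply: max_seqE => [|x]; first by apply/mem_takeP; [lia | exists j].
  by case/mem_takeP=> [|k ki <-]; [lia | apply: jmax].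
case: andP => // -[lt /hasP[x /leq_max_seq]]; rewrite mE /=.
have := rec lt; lia.
Qed.

Section PermWord.

Variables (n : nat) (s : seq nat).
Hypothesis perm_s : perm_eq s (iota 0 n).

Lemma size_perm_word : size s = n.
Proof. by rewrite (perm_size perm_s) size_iota. Qed.

Lemma uniq_perm_word : uniq s.
Proof. by rewrite (perm_uniq perm_s) iota_uniq. Qed.

Lemma mem_perm_word v : (v \in s) = (v < n).
Proof. by rewrite (perm_mem perm_s) mem_iota add0n. Qed.

Lemma nth_perm_word i : i < n -> nth 0 s i < n.
Proof. by move=> ?; rewrite -mem_perm_word mem_nth // size_perm_word. Qed.

Lemma index_perm_word v : v < n -> exists2 i, i < n & nth 0 s i = v.
Proof.
rewrite -mem_perm_word => vs; exists (index v s); last exact: nth_index.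
by rewrite -[X in _ < X]size_perm_word index_mem.
Qed.

End PermWord.

Lemma perm_upto_nth (N : nat) (s : seq nat) :
  perm_eq s (iota 0 N.+1) -> perm_upto N (nth 0 s).
Proof.
move=> ps; split=> [i iN|i j iN jN e|v vN].
- exact: (nth_perm_word ps).
- by apply/eqP; rewrite -(nth_uniq 0 _ _ (uniq_perm_word ps)) ?(size_perm_word ps) ?e.
- exact: (index_perm_word ps).
Qed.

(** Every letter occurs in [w], so the reading prescribes every value of the word being read. *)
Lemma reads_as_inj (n : nat) (s s' w : seq nat) :
  size s = n -> size s' = n -> perm_eq w (iota 0 n) ->
  reads_as s w -> reads_as s' w -> s = s'.
Proof.
move=> sz sz' pw /reads_asP r /reads_asP r'.
apply: (@eq_from_nth _ 0); first by rewrite sz.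
move=> v; rewrite sz => /(index_perm_word pw)[i iN <-].
by rewrite r ?r' // (size_perm_word pw).
Qed.

(** * Words of permutations and the fundamental bijection *)

(** Zero-based one-line notation, in which a letter serves directly as a position. *)
Definition word (n : nat) (p : 'S_n) : seq nat := [seq val (p i) | i <- enum 'I_n].

Lemma one_line_word (n : nat) (p : 'S_n) : one_line p = map S (word p).
Proof. by rewrite /one_line /word -map_comp. Qed.

Lemma word_theta (n : nat) (p : 'S_n) :
  word (theta p) = [seq val i | i <- flatten (std_cycles p)].
Proof.
by apply: (inj_map succn_inj); rewrite -one_line_word one_line_theta -map_comp.
Qed.

Lemma nth_word (n : nat) (p : 'S_n) (i : 'I_n) : nth 0 (word p) i = p i.
Proof. by rewrite (nth_map i) ?size_enum_ord ?nth_ord_enum. Qed.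

Lemma word_inj (n : nat) : injective (@word n).
Proof.
by move=> p q e; apply/permP => i; apply: val_inj; rewrite /= -!nth_word e.
Qed.

Lemma perm_word (n : nat) (p : 'S_n) : perm_eq (word p) (iota 0 n).
Proof.
apply: uniq_perm; rewrite ?iota_uniq //.
  rewrite map_inj_uniq ?enum_uniq // => i j /val_inj; exact: perm_inj.
move=> v; rewrite mem_iota add0n /=; apply/mapP/idP => [[i _ ->]|vn]; first exact: ltn_ord.
by exists ((p^-1)%g (Ordinal vn)); rewrite ?mem_enum // permKV.
Qed.

Lemma word_surj (n : nat) (s : seq nat) :
  perm_eq s (iota 0 n) -> exists p : 'S_n, word p = s.
Proof.
move=> ps.
have sn (i : 'I_n) : nth 0 s i < n by apply: (nth_perm_word ps).
have inj : injective (fun i => Ordinal (sn i)).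
  move=> i j [] /eqP; rewrite nth_uniq ?(uniq_perm_word ps) ?(size_perm_word ps) //.
  by move/eqP/val_inj.
exists (perm inj); apply: (@eq_from_nth _ 0).
  by rewrite !(@size_perm_word n) // perm_word.
move=> i; rewrite (size_perm_word (perm_word _)) => iN.
by rewrite -[i]/(val (Ordinal iN)) nth_word permE.
Qed.

Definition max_first_cycle (f : nat -> nat) (m : nat) (c : seq nat) : Prop :=
  exists c', [/\ c = m :: c', fpath f m c', f (last m c') = m & all (gtn m) c'].

(** Induction on the list of maxima from its end: the new leader [m] exceeds all earlier letters, so
    appending its cycle does not change how the earlier cycles close. *)
Lemma next_in_cycle_flatten (f : nat -> nat) (cyc : nat -> seq nat) (ms : seq nat) :
  pairwise ltn ms -> {in ms, forall m, max_first_cycle f m (cyc m)} ->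
  forall i, i < size (flatten (map cyc ms)) ->
    f (nth 0 (flatten (map cyc ms)) i) = next_in_cycle (flatten (map cyc ms)) i.
Proof.
elim/last_ind: ms => //= ms m IH; rewrite pairwise_rcons => /andP[/allP lt_m srt] good.
have ms_in k : k \in ms -> k \in rcons ms m by rewrite mem_rcons inE => ->; rewrite orbT.
have {}IH : forall i, i < size (flatten (map cyc ms)) ->
    f (nth 0 (flatten (map cyc ms)) i) = next_in_cycle (flatten (map cyc ms)) i.
  by apply: IH => // k /ms_in/good.
have {lt_m} lt_F x : x \in flatten (map cyc ms) -> x < m.
  case/flatten_mapP=> k kms; have [c' [-> _ _ /allP c'k]] := good k (ms_in k kms).
  by have := lt_m k kms; rewrite inE => ? /predU1P[->|/c'k] //=; lia.
have [c' [cE /(pathP 0) fc' flast c'm]] : max_first_cycle f m (cyc m).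
  by apply: good; rewrite mem_rcons mem_head.
rewrite map_rcons flatten_rcons cE.
set F := flatten _ in IH lt_F *; move=> i; rewrite size_cat => isz.
have [iF|Fi] := ltnP i (size F).
  rewrite nth_cat iF IH // /next_in_cycle size_cat takel_cat // nth_cat.
  have [iF1|Fi1] := ltnP i.+1 (size F); first by rewrite (leq_trans iF1) ?leq_addr.
  (* At the last letter of [F] the next letter is now [m], a left-to-right maximum, so the running
     maximum is still returned. *)
  have -> : i.+1 - size F = 0 by lia.
  by rewrite /=; case: andP => // -[_ /hasP[x /mem_take /lt_F]] /=; lia.
have m_take : m \in take i.+1 (F ++ m :: c').
  apply/mem_takeP; first by rewrite size_cat.
  by exists (size F); rewrite // nth_cat ltnn subnn.
have nthE k : size F <= k -> nth 0 (F ++ m :: c') k = nth 0 (m :: c') (k - size F).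
  by move=> Fk; rewrite nth_cat ltnNge Fk.
rewrite /next_in_cycle !nthE ?(leqW Fi) // subSn //= size_cat /=.
have [lt|ge] := ltnP (i - size F) (size c').
  rewrite (eqP (fc' _ lt)) (_ : i.+1 < _) /=; last lia.
  case: hasP => // -[]; exists m => //=.
  by apply: (allP c'm); rewrite mem_nth.
have -> : i - size F = size c' by move: isz => /=; lia.
rewrite nth_last flast ltnNge [_ + _ <= _](_ : _ = true) /=; last lia.
rewrite take_oversize ?size_cat //=; last lia.
rewrite (@max_seqE _ m) ?mem_cat ?mem_head ?orbT // => x.
rewrite mem_cat inE => /orP[/lt_F|/predU1P[->|/(allP c'm)]] //=; lia.
Qed.

Lemma reads_as_theta (n : nat) (p : 'S_n) : reads_as (word p) (word (theta p)).
Proof.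
pose ms := [seq val m | m <- enum 'I_n & cycle_max p m].
pose cyc k := oapp (fun m : 'I_n => [seq val i | i <- traject p m #|porbit p m|])
  [::] (insub k).
have wE : word (theta p) = flatten (map cyc ms).
  rewrite word_theta map_flatten /std_cycles -!map_comp; congr flatten.
  by apply: eq_map => m /=; rewrite /cyc valK.
rewrite wE; apply/reads_asP; apply: next_in_cycle_flatten.
  rewrite -(sorted_pairwise ltn_trans) /ms sorted_map; apply: sorted_filter => [x y z|]; first exact: ltn_trans.
  by rewrite -(@sorted_map _ _ val ltn) val_enum_ord iota_ltn_sorted.
move=> k /mapP[m + ->{k}]; rewrite mem_filter => /andP[/forall_inP mmax _].
rewrite /cyc valK /=.
have : uniq (traject p m #|porbit p m|) by exact: uniq_traject_porbit.
have itm : iter #|porbit p m| p m = m by exact: iter_porbit.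
have mem_tr x : (x \in traject p m #|porbit p m|) = (x \in porbit p m).
  by rewrite porbit_traject.
have : 0 < #|porbit p m| by rewrite card_gt0; apply/set0Pn; exists m; exact: porbit_id.
case: #|porbit p m| itm mem_tr => // r itm mem_tr _ /=.
move=> /andP[m_notin _]; exists [seq val i | i <- traject p (p m) r]; split=> //.
- rewrite path_map (@eq_path _ _ (frel p)) ?fpath_traject // => x y /=.
  by rewrite nth_word.
- by rewrite last_map nth_word last_traject; apply: congr1 itm.
apply/allP => _ /mapP[x xt ->] /=; rewrite ltn_neqAle mmax ?andbT; last first.
  by rewrite -mem_tr /= inE xt orbT.
by apply: contraNneq m_notin => /val_inj xm; rewrite -{1}xm.
Qed.

Lemma theta_inj (n : nat) : injective (@theta n).
Proof.
move=> p q e; apply: word_inj; apply: (@reads_as_inj n _ _ (word (theta p))).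
- exact: size_perm_word (perm_word p).
- exact: size_perm_word (perm_word q).
- exact: perm_word.
- exact: reads_as_theta.
by rewrite e reads_as_theta.
Qed.

(** Injectivity on a finite type gives [q] a preimage under [theta], and a reading determines the
    word it reads. *)
Lemma thetaP (n : nat) (p q : 'S_n) :
  reflect (theta p = q) (reads_as (word p) (word q)).
Proof.
apply: (iffP idP) => [r|<-]; last exact: reads_as_theta.
rewrite -[q](f_invF (@theta_inj n)); congr theta.
apply: word_inj; apply: (@reads_as_inj n _ _ (word q)) => //.
- exact: size_perm_word (perm_word p).
- exact: size_perm_word (perm_word _).
- exact: perm_word.
by rewrite -{2}[q](f_invF (@theta_inj n)) reads_as_theta.
Qed.

(** * Pattern avoidance *)

(** A bounded check over triples of positions, which can be evaluated on words of length 4. *)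
Definition avoids3 (r : nat -> nat -> nat -> bool) (s : seq nat) : bool :=
  all (fun k => all (fun j => all (fun i =>
    ~~ r (nth 0 s i) (nth 0 s j) (nth 0 s k)) (iota 0 j)) (iota 0 k))
  (iota 0 (size s)).

Lemma avoids3P (r : nat -> nat -> nat -> bool) (s : seq nat) :
  reflect (forall i j k, i < j -> j < k -> k < size s ->
             ~~ r (nth 0 s i) (nth 0 s j) (nth 0 s k))
          (avoids3 r s).
Proof.
apply: (iffP allP) => [h i j k ij jk ks|h k].
  have /allP/(_ j) : all (fun j => all (fun i =>
      ~~ r (nth 0 s i) (nth 0 s j) (nth 0 s k)) (iota 0 j)) (iota 0 k).
    by apply: h; rewrite mem_iota.
  by rewrite mem_iota => /(_ jk)/allP; apply; rewrite mem_iota.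
rewrite mem_iota => ks; apply/allP => j; rewrite mem_iota => jk.
by apply/allP => i; rewrite mem_iota => ij; apply: h.
Qed.

Definition is213 (x y z : nat) := (y < x) && (x < z).
Definition is132 (x y z : nat) := (x < z) && (z < y).
Definition is123 (x y z : nat) := (x < y) && (y < z).

Lemma order_iso3P (x y z x' y' z' : nat) :
  reflect ([/\ (x < y) = (x' < y'), (x < z) = (x' < z') & (y < z) = (y' < z')] /\
           [/\ (y < x) = (y' < x'), (z < x) = (z' < x') & (z < y) = (z' < y')])
          (order_iso [:: x; y; z] [:: x'; y'; z']).
Proof.
rewrite /order_iso /=; apply: (iffP forallP) => [h|[[h1 h2 h3] [h4 h5 h6]] i].
  pose o k (hk : k < 3) := @Ordinal 3 k hk.
  have {}h i j := eqP (forallP (h i) j).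
  split; split.
  - exact: (h (o 0 isT) (o 1 isT)).
  - exact: (h (o 0 isT) (o 2 isT)).
  - exact: (h (o 1 isT) (o 2 isT)).
  - exact: (h (o 1 isT) (o 0 isT)).
  - exact: (h (o 2 isT) (o 0 isT)).
  - exact: (h (o 2 isT) (o 1 isT)).
apply/forallP => j; apply/eqP.
by case: i => -[|[|[|]]] //=; case: j => -[|[|[|]]] //=; rewrite ?ltnn.
Qed.

Lemma order_iso213 x y z : order_iso [:: x; y; z] [:: 2; 1; 3] = is213 x y z.
Proof. by rewrite /is213; apply/order_iso3P/idP => [[[? ? ?] [? ? ?]]|?]; try (split; split); lia. Qed.

Lemma order_iso132 x y z : order_iso [:: x; y; z] [:: 1; 3; 2] = is132 x y z.
Proof. by rewrite /is132; apply/order_iso3P/idP => [[[? ? ?] [? ? ?]]|?]; try (split; split); lia. Qed.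

Lemma order_iso123 x y z : order_iso [:: x; y; z] [:: 1; 2; 3] = is123 x y z.
Proof. by rewrite /is123; apply/order_iso3P/idP => [[[? ? ?] [? ? ?]]|?]; try (split; split); lia. Qed.

Lemma subseq_consP (x : nat) (s w : seq nat) :
  reflect (exists i, [/\ i < size w, nth 0 w i = x & subseq s (drop i.+1 w)])
          (subseq (x :: s) w).
Proof.
apply: (iffP idP) => [|[i [iw <- sw]]]; last first.
  apply: subseq_trans (drop_subseq w i); rewrite (drop_nth 0) //=.
  by rewrite eqxx.
elim: w => //= y w IH; case: eqVneq => [-> sw|_ /IH[i [iw <- sw]]].
  by exists 0; rewrite drop0.
by exists i.+1.
Qed.

(** The shift invariance of [r] absorbs the passage from the letters of [one_line] to the zero-based
    ones of [word]. *)
Lemma avoidsE (r : nat -> nat -> nat -> bool) (n : nat) (p : 'S_n) (x y z : nat) :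
  (forall u v w, order_iso [:: u; v; w] [:: x; y; z] = r u v w) ->
  (forall u v w, r u.+1 v.+1 w.+1 = r u v w) ->
  avoids p [:: x; y; z] = avoids3 r (word p).
Proof.
move=> rE rS; rewrite /avoids one_line_word.
have nS i : i < size (word p) -> nth 0 (map S (word p)) i = (nth 0 (word p) i).+1.
  exact: nth_map.
apply/idP/avoids3P => [/containsP h i j k ij jk ks|h].
  apply/negP => rijk; apply: h.
  exists [:: nth 0 (map S (word p)) i; nth 0 (map S (word p)) j;
             nth 0 (map S (word p)) k]; last by rewrite rE !nS ?rS //; lia.
  apply/subseq_consP; exists i; split=> //; first by rewrite size_map; lia.
  (* Positions are now counted from the start of the suffix left after position [i]. *)
  apply/subseq_consP; exists (j - i.+1).
  have dE : (j - i.+1).+1 + i.+1 = j.+1 by lia.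
  rewrite size_drop size_map nth_drop subnKC // drop_drop dE; split=> //; first lia.
  apply/subseq_consP; exists (k - j.+1).
  by rewrite size_drop size_map nth_drop subnKC ?sub0seq //; split=> //; lia.
apply/containsP => -[] [|u [|v [|w [|? ?]]]] //; rewrite rE.
case/subseq_consP=> i [isz <-] /subseq_consP[j []].
rewrite size_drop size_map nth_drop drop_drop => jsz <- /subseq_consP[k []].
rewrite size_drop size_map nth_drop => ksz <- _; rewrite size_map in isz.
rewrite !nS ?rS; try lia.
by apply/negP; apply: h; lia.
Qed.

(** * Direct sums with a fixed point *)

(** The direct sum of a one-letter word with [s]. *)
Definition sum1l (s : seq nat) : seq nat := 0 :: map S s.

Lemma sum1l_inj : injective sum1l.
Proof. by move=> s t [] /(inj_map succn_inj). Qed.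

Lemma perm_sum1l (n : nat) (s : seq nat) :
  perm_eq (sum1l s) (iota 0 n.+1) = perm_eq s (iota 0 n).
Proof.
rewrite /= perm_cons (iotaDl 1 0 n) -[map (addn 1) _]/(map S _).
apply/idP/idP; last exact: perm_map.
exact: (perm_map_inj succn_inj).
Qed.

Lemma max_seq_map_succ (t : seq nat) : 0 < size t -> max_seq (map S t) = (max_seq t).+1.
Proof. by elim: t => //= x [|y t] IH _ //; rewrite IH // maxnSS. Qed.

Lemma next_in_cycle_sum1l (w : seq nat) (i : nat) : i < size w ->
  next_in_cycle (sum1l w) i.+1 = (next_in_cycle w i).+1.
Proof.
move=> iw; rewrite /next_in_cycle /sum1l /= size_map ltnS.
have [lt|ge] := ltnP i.+1 (size w); last first.
  by rewrite -map_take max_seq_map_succ ?max0n // size_takel //; lia.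
rewrite (nth_map 0) // -map_take has_map /= (eq_has (a2 := ltn (nth 0 w i.+1))) //.
case: ifP => // _.
by rewrite max_seq_map_succ ?max0n // size_takel //; lia.
Qed.

(** The leading 0 is a cycle of its own, and shifting all other letters preserves left-to-right
    maxima. *)
Lemma reads_as_sum1l (n : nat) (s w : seq nat) :
  size s = n -> perm_eq w (iota 0 n) ->
  reads_as (sum1l s) (sum1l w) = reads_as s w.
Proof.
move=> szs pw; have szw := size_perm_word pw.
have nS i : i < n -> nth 0 (sum1l w) i.+1 = (nth 0 w i).+1.
  by move=> iN; rewrite /= (nth_map 0) // szw.
have sS i : i < n -> nth 0 (sum1l s) (nth 0 w i).+1 = (nth 0 s (nth 0 w i)).+1.
  by move=> iN; rewrite /= (nth_map 0) // szs (nth_perm_word pw).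
apply/reads_asP/reads_asP => h i; rewrite ?szw ?[size (sum1l w)]/= ?size_map ?szw.
  move=> iN; have := h i.+1; rewrite nS // sS // next_in_cycle_sum1l ?szw //.
  by rewrite [size (sum1l w)]/= size_map szw => /(_ iN) [].
case: i => [_|i iN]; last by rewrite nS // sS // next_in_cycle_sum1l ?szw // h ?szw.
by rewrite /next_in_cycle /= take0 /= andbF.
Qed.

Lemma perm_rcons_top (n : nat) (s : seq nat) :
  perm_eq (rcons s n) (iota 0 n.+1) = perm_eq s (iota 0 n).
Proof.
by rewrite -(addn1 n) iotaD add0n -cats1 perm_cat2r.
Qed.

Lemma next_in_cycle_rcons_top (n : nat) (w : seq nat) (i : nat) :
  perm_eq w (iota 0 n) -> i < n -> next_in_cycle (rcons w n) i = next_in_cycle w i.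
Proof.
move=> pw iN; have szw := size_perm_word pw.
rewrite /next_in_cycle size_rcons szw -cats1 takel_cat ?szw // ltnS iN nth_cat szw.
have [lt|ge] := ltnP i.+1 n => //=.
rewrite (_ : i.+1 - n = 0) /=; last lia.
by case: hasP => // -[x /mem_take]; rewrite (mem_perm_word pw) /=; lia.
Qed.

(** The appended letter is a left-to-right maximum: it forms the last cycle alone and the earlier
    cycles close as before. *)
Lemma reads_as_rcons_top (n : nat) (s w : seq nat) :
  size s = n -> perm_eq w (iota 0 n) ->
  reads_as (rcons s n) (rcons w n) = reads_as s w.
Proof.
move=> szs pw; have szw := size_perm_word pw.
have nw i : i < n -> nth 0 (rcons w n) i = nth 0 w i.
  by move=> iN; rewrite nth_rcons szw iN.
have ns i : i < n -> nth 0 (rcons s n) (nth 0 w i) = nth 0 s (nth 0 w i).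
  by move=> iN; rewrite nth_rcons szs (nth_perm_word pw).
apply/reads_asP/reads_asP => h i; rewrite ?size_rcons ?szw => iN.
  by rewrite -ns // -nw // h ?size_rcons ?szw ?next_in_cycle_rcons_top //; lia.
have [lt|ge] := ltnP i n.
  by rewrite nw // ns // next_in_cycle_rcons_top // h ?szw.
have -> : i = n by lia.
have nn t : size t = n -> nth 0 (rcons t n) n = n.
  by move=> szt; rewrite nth_rcons szt ltnn eqxx.
rewrite !nn // /next_in_cycle size_rcons szw ltnn /=.
rewrite take_oversize ?size_rcons ?szw // (@max_seqE _ n) ?mem_rcons ?mem_head // => x.
by rewrite mem_rcons inE (mem_perm_word pw) => /predU1P[->|]//; lia.
Qed.

(** * The fixed points of the square *)

(** The witness [w] plays the role of the image under [theta]; searching for it keeps the test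
    computable on words. *)
Definition theta2_fixed (n : nat) (s : seq nat) : bool :=
  has (fun w => reads_as s w && reads_as w s) (permutations (iota 0 n)).

Lemma theta2_fixedP (n : nat) (s : seq nat) :
  reflect (exists w, [/\ perm_eq w (iota 0 n), reads_as s w & reads_as w s])
          (theta2_fixed n s).
Proof.
apply: (iffP hasP) => [[w]|[w [pw sw ws]]].
  by rewrite mem_permutations => pw /andP[sw ws]; exists w.
by exists w; rewrite ?mem_permutations // sw.
Qed.

Lemma theta2_fixedE (n : nat) (p : 'S_n) :
  (theta (theta p) == p) = theta2_fixed n (word p).
Proof.
apply/eqP/theta2_fixedP => [e|[w [/word_surj[q <-] /thetaP-> /thetaP->//]]].
exists (word (theta p)); rewrite perm_word reads_as_theta; split=> //.
by apply/thetaP.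
Qed.

Lemma f2E (n : nat) (r : nat -> nat -> nat -> bool) (x y z : nat) (L : seq (seq nat)) :
  (forall u v w, order_iso [:: u; v; w] [:: x; y; z] = r u v w) ->
  (forall u v w, r u.+1 v.+1 w.+1 = r u v w) ->
  uniq L -> {in L, forall s, perm_eq s (iota 0 n)} ->
  (forall s, perm_eq s (iota 0 n) ->
     avoids3 r s && theta2_fixed n s = (s \in L)) ->
  f2 n [:: x; y; z] = size L.
Proof.
move=> rE rS uL permL LE.
rewrite /f2 cardE -(size_map (@word n)); apply/perm_size/uniq_perm => //.
  by rewrite map_inj_uniq ?enum_uniq //; apply: word_inj.
move=> s; apply/mapP/idP => [[p]|sL].
  by rewrite mem_enum inE (avoidsE _ rE rS) theta2_fixedE LE ?perm_word // => ? ->.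
have [p pE] := word_surj (permL s sL); exists p => //.
by rewrite mem_enum inE (avoidsE _ rE rS) theta2_fixedE LE ?perm_word // pE.
Qed.

Lemma theta2_fixed_pair (N : nat) (s : seq nat) :
  perm_eq s (iota 0 N.+1) -> theta2_fixed N.+1 s ->
  exists w, [/\ perm_eq w (iota 0 N.+1), reads_as s w, reads_as w s
              & theta_pair N (nth 0 s) (nth 0 w)].
Proof.
move=> ps /theta2_fixedP[w [pw sw ws]]; exists w; split=> //; split.
- exact: perm_upto_nth.
- exact: perm_upto_nth.
- exact: reads_as_cycle_reading (size_perm_word pw) sw.
- exact: reads_as_cycle_reading (size_perm_word ps) ws.
Qed.

(** If [W] had [N] at the end, the closing of the last cycle of [P] would give [P N = N]; so when
    [N] is not fixed by [P], both maxima lie before the end. *)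
Lemma theta_pair_top (N : nat) (P W : nat -> nat) : theta_pair N P W ->
  P N = N \/ exists a b, [/\ a < N, b < N, W a = N & P b = N].
Proof.
move=> [pP pW rPW rWP]; have [_ _ sP] := pP; have [_ _ sW] := pW.
have [b bN Pb] := sP N (leqnn N); have [a aN Wa] := sW N (leqnn N).
have [e|/eqP PN] := eqVneq (P N) N; [by left | right; exists a, b].
have bN' : b <> N by move=> e; apply: PN; rewrite -{1}e.
have aN' : a <> N.
  move=> e; apply: PN; have := top_cycle_closes pW rPW.
  by rewrite -{1}e Wa.
by split=> //; lia.
Qed.

(** * Removal of the fixed point and the lists of fixed words *)

Lemma theta_pair0 (N : nat) (P W : nat -> nat) :
  0 < N -> theta_pair N P W -> P 0 = 0 -> W 0 = 0.
Proof.
move=> N0 [[_ iP _] _ _ [_ rec_max]] P0; rewrite -{1}P0 -[RHS]P0.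
apply: rec_max => // [[]//|_]; have := iP 0 1; lia.
Qed.

Lemma sum1lP (n : nat) (s : seq nat) : perm_eq s (iota 0 n.+1) -> nth 0 s 0 = 0 ->
  exists2 t, perm_eq t (iota 0 n) & s = sum1l t.
Proof.
case: s => [/perm_size//|x s ps /= x0]; rewrite x0 in ps *.
have sE : s = map S (map predn s).
  rewrite -map_comp map_id_in // => y ys /=; rewrite prednK //.
  by have /andP[+ _] := uniq_perm_word ps; case: y ys => // ->.
exists (map predn s); last by rewrite /sum1l -sE.
by rewrite -perm_sum1l /sum1l -sE.
Qed.

Lemma rcons_topP (n : nat) (s : seq nat) : perm_eq s (iota 0 n.+1) -> nth 0 s n = n ->
  exists2 t, perm_eq t (iota 0 n) & s = rcons t n.
Proof.
case/lastP: s => [/perm_size//|t x pt].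
have szt : size t = n by have := size_perm_word pt; rewrite size_rcons => -[].
rewrite nth_rcons szt ltnn eqxx => xn; rewrite {x}xn in pt *.
by exists t; rewrite // -perm_rcons_top.
Qed.

Lemma avoids213_sum1l (s : seq nat) : avoids3 is213 (sum1l s) = avoids3 is213 s.
Proof.
have nS i : i < size s -> nth 0 (sum1l s) i.+1 = (nth 0 s i).+1.
  by move=> iN; rewrite /= (nth_map 0).
apply/avoids3P/avoids3P => h i j k ij jk ks.
  have := h i.+1 j.+1 k.+1 ij jk; rewrite [size _]/= size_map ltnS => /(_ ks).
  by rewrite !nS //; lia.
rewrite [size _]/= size_map in ks.
case: i j k ij jk ks => [|i] [|j] [|k] // ij jk ks.
by rewrite !nS; try lia; apply: h.
Qed.

Lemma avoids132_rcons_top (n : nat) (s : seq nat) : perm_eq s (iota 0 n) ->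
  avoids3 is132 (rcons s n) = avoids3 is132 s.
Proof.
move=> ps; have szs := size_perm_word ps.
have nw i : i < n -> nth 0 (rcons s n) i = nth 0 s i.
  by move=> iN; rewrite nth_rcons szs iN.
apply/avoids3P/avoids3P => h i j k ij jk; rewrite ?size_rcons szs => ks.
  have := h i j k ij jk; rewrite size_rcons szs => /(_ (ltnW ks)).
  by rewrite !nw //; lia.
have [lt|ge] := ltnP k n; first by rewrite !nw; try lia; apply: h; rewrite ?szs.
have jn : j < n by lia.
have -> : k = n by lia.
have -> : nth 0 (rcons s n) n = n by rewrite nth_rcons szs ltnn eqxx.
rewrite (nw j) //.
rewrite /is132; have := nth_perm_word ps jn; lia.
Qed.

(* The words of length m + 4. *)
Fixpoint fixed213 (m : nat) : seq (seq nat) :=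
  if m is m'.+1 then map sum1l (fixed213 m')
  else [:: [:: 0; 1; 2; 3]; [:: 0; 1; 3; 2]; [:: 2; 3; 1; 0]; [:: 3; 0; 2; 1]].

Fixpoint fixed132 (m : nat) : seq (seq nat) :=
  if m is m'.+1 then map (rcons^~ m'.+4) (fixed132 m')
  else [:: [:: 0; 1; 2; 3]; [:: 1; 0; 2; 3]; [:: 2; 3; 1; 0]].

Lemma fixed213P (m : nat) (s : seq nat) : perm_eq s (iota 0 m.+4) ->
  avoids3 is213 s && theta2_fixed m.+4 s = (s \in fixed213 m).
Proof.
elim: m s => [|m IH] s ps.
  (* The base case is a computation over all words of length 4. *)
  have /allP/(_ s) : all (fun s => (avoids3 is213 s && theta2_fixed 4 s) == (s \in fixed213 0))
    (permutations (iota 0 4)) by vm_compute.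
  by rewrite mem_permutations => /(_ ps)/eqP.
apply/andP/mapP => [[av fx]|[t tL sE]].
  have [w [pw sw ws pair]] := theta2_fixed_pair ps fx.
  have av' i j k : i < j -> j < k -> k <= m.+4 -> nth 0 s j < nth 0 s i ->
      nth 0 s i < nth 0 s k -> False.
    move=> ij jk kN; have /avoids3P/(_ i j k ij jk) := av.
    by rewrite (size_perm_word ps) /is213 => /(_ kN); lia.
  have s0 : nth 0 s 0 = 0.
    have [top|[a [b [aN bN Wa Pb]]]] := theta_pair_top pair; last first.
      exact: (avoid213_top aN bN Wa Pb pair).
    (* With the maximum at the end, a nonzero first letter, the letter 0 and the maximum would form
       a 213. *)
    have [k kN sk] := index_perm_word ps (ltn0Sn _).
    have [/eqP k0|k0] := posnP k; first by rewrite -[X in nth _ _ X](eqP k0).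
    have kN' : k <> m.+4 by move=> e; move: sk; rewrite e top.
    have [//|s0] := posnP (nth 0 s 0).
    have := av' 0 k m.+4 k0; have := nth_perm_word ps (ltn0Sn _).
    have [_ iP _] := perm_upto_nth ps; have := iP 0 m.+4; lia.
  have w0 := theta_pair0 (ltn0Sn _) pair s0.
  have [t pt sE] := sum1lP ps s0; have [u pu wE] := sum1lP pw w0.
  exists t => //; rewrite -IH // -avoids213_sum1l -sE av.
  apply/theta2_fixedP; exists u; split=> //.
    by rewrite -(reads_as_sum1l (size_perm_word pt)) // -sE -wE.
  by rewrite -(reads_as_sum1l (size_perm_word pu)) // -sE -wE.
have pt : perm_eq t (iota 0 m.+4) by rewrite -perm_sum1l -sE.
move: tL; rewrite sE -IH // avoids213_sum1l => /andP[-> /theta2_fixedP[u [pu tu ut]]].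
split=> //; apply/theta2_fixedP; exists (sum1l u).
rewrite perm_sum1l (reads_as_sum1l (size_perm_word pt)) //.
by rewrite (reads_as_sum1l (size_perm_word pu)).
Qed.

Lemma fixed132P (m : nat) (s : seq nat) : perm_eq s (iota 0 m.+4) ->
  avoids3 is132 s && theta2_fixed m.+4 s = (s \in fixed132 m).
Proof.
elim: m s => [|m IH] s ps.
  have /allP/(_ s) : all (fun s => (avoids3 is132 s && theta2_fixed 4 s) == (s \in fixed132 0))
    (permutations (iota 0 4)) by vm_compute.
  by rewrite mem_permutations => /(_ ps)/eqP.
apply/andP/mapP => [[av fx]|[t tL sE]].
  have [w [pw sw ws pair]] := theta2_fixed_pair ps fx.
  have sN : nth 0 s m.+4 = m.+4.
    have [//|[a [b [aN bN Wa Pb]]]] := theta_pair_top pair.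
    case: (avoid132_top aN bN Wa Pb pair) => // i j k ij jk kN.
    have /avoids3P/(_ i j k ij jk) := av.
    by rewrite (size_perm_word ps) /is132 => /(_ kN); lia.
  (* The fixed top letter passes to [w] because the last cycle of [w], listed by [s], closes at
     it. *)
  have wN : nth 0 w m.+4 = m.+4.
    by case: pair => pP _ _ rWP; rewrite -{1}sN (top_cycle_closes pP rWP).
  have [t pt sE] := rcons_topP ps sN; have [u pu wE] := rcons_topP pw wN.
  exists t => //; rewrite -IH // -(avoids132_rcons_top pt) -sE av.
  apply/theta2_fixedP; exists u; split=> //.
    by rewrite -(reads_as_rcons_top (size_perm_word pt)) // -sE -wE.
  by rewrite -(reads_as_rcons_top (size_perm_word pu)) // -sE -wE.
have pt : perm_eq t (iota 0 m.+4) by rewrite -perm_rcons_top -sE.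
move: tL; rewrite sE -IH // (avoids132_rcons_top pt).
move=> /andP[-> /theta2_fixedP[u [pu tu ut]]].
split=> //; apply/theta2_fixedP; exists (rcons u m.+4).
rewrite perm_rcons_top (reads_as_rcons_top (size_perm_word pt)) //.
by rewrite (reads_as_rcons_top (size_perm_word pu)).
Qed.

Lemma no_fixed123 (N : nat) (s : seq nat) : 4 <= N -> perm_eq s (iota 0 N.+1) ->
  avoids3 is123 s && theta2_fixed N.+1 s = false.
Proof.
move=> N4 ps; apply/negP => /andP[av /(theta2_fixed_pair ps)[w [pw sw ws pair]]].
have av' i j k : i < j -> j < k -> k <= N -> nth 0 s i < nth 0 s j ->
    nth 0 s j < nth 0 s k -> False.
  move=> ij jk kN; have /avoids3P/(_ i j k ij jk) := av.
  by rewrite (size_perm_word ps) /is123 => /(_ kN); lia.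
have [top|[a [b [aN bN Wa Pb]]]] := theta_pair_top pair.
  exact: avoid123_fixed_top N4 pair top av'.
exact: (avoid123_top aN bN Wa Pb pair).
Qed.

(** * Counting the listed words *)

Lemma perm_fixed213 (m : nat) : {in fixed213 m, forall s, perm_eq s (iota 0 m.+4)}.
Proof.
elim: m => [|m IH] s; first by rewrite !inE => /or4P[] /eqP->.
by case/mapP=> t /IH pt ->; rewrite perm_sum1l.
Qed.

Lemma perm_fixed132 (m : nat) : {in fixed132 m, forall s, perm_eq s (iota 0 m.+4)}.
Proof.
elim: m => [|m IH] s; first by rewrite !inE => /or3P[] /eqP->.
by case/mapP=> t /IH pt ->; rewrite perm_rcons_top.
Qed.

Lemma uniq_fixed213 (m : nat) : uniq (fixed213 m).
Proof. by elim: m => //= m IH; rewrite map_inj_uniq //; exact: sum1l_inj. Qed.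

Lemma uniq_fixed132 (m : nat) : uniq (fixed132 m).
Proof.
by elim: m => //= m IH; rewrite map_inj_uniq // => s t /rcons_inj[].
Qed.

Lemma size_fixed213 (m : nat) : size (fixed213 m) = 4.
Proof. by elim: m => //= m; rewrite size_map. Qed.

Lemma size_fixed132 (m : nat) : size (fixed132 m) = 3.
Proof. by elim: m => //= m; rewrite size_map. Qed.

Theorem theorem5p5 (n : nat) (hn : 5 <= n) :
  [/\ f2 n [:: 2; 1; 3] = 4, f2 n [:: 1; 3; 2] = 3 & f2 n [:: 1; 2; 3] = 0].
Proof.
have [m ->] : exists m, n = m.+1.+4 by exists (n - 5); lia.
split.
- rewrite -[RHS](size_fixed213 m.+1); apply: (f2E order_iso213) => //.
  + exact: uniq_fixed213.
  + exact: perm_fixed213.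
  + exact: fixed213P.
- rewrite -[RHS](size_fixed132 m.+1); apply: (f2E order_iso132) => //.
  + exact: uniq_fixed132.
  + exact: perm_fixed132.
  + exact: fixed132P.
- rewrite -[RHS]/(size (@nil (seq nat))); apply: (f2E order_iso123) => //.
  by move=> s ps; rewrite no_fixed123.
Qed.
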